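(* Let $q\in\mathbb{C}$ with $0<|q|<1$, and let $x,z\in\mathbb{C}$ satisfy $|xq|<1$, $|zq^3|<1$, and $z\neq -q^{-r}$ for every integer $r\ge 1$. Then $$\sum_{m,n\geq 1}\frac{(-1)^mq^{2mn+m}x^nz^m}{(1+zq^n)(1-q^{2m-1})} =xzq^2\sum_{k=0}^\infty \frac{x^kq^{k}}{1+zq^{2k+1}}\sum_{k=0}^\infty \frac{x^kq^{2k}}{1+zq^{2k+1}} -xzq^2\sum_{k=0}^\infty \frac{q^{k}}{1+zq^{2k+1}}\sum_{k=0}^\infty \frac{x^kq^{k}}{1+zq^{k+1}}.$$
   Context: Here $q$ is a complex number with $0<|q|<1$, and $0^0=1$. On the right-hand side each of the two terms is $xzq^2$ times a product of two separate single series. *)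

(* Defs.v *)
From Stdlib Require Export Reals List.
From Coquelicot Require Export Coquelicot.

Local Open Scope C_scope.

Definition Csum_list {I : Type} (f : I -> C) (F : list I) : C :=
  fold_right (fun i acc => f i + acc) (RtoC 0) F.

(* [s] is the sum of the family [f] over the index set [P]: the limit of the
   sums over the finite subsets of [P], ordered by inclusion.  Finite subsets
   are duplicate-free lists.  For complex families this is absolute
   convergence, so the sum does not depend on any order of summation. *)
Definition is_unordered_sum {I : Type} (P : I -> Prop) (f : I -> C) (s : C)
  : Prop :=
  forall eps : posreal, exists F0 : list I,
    List.Forall P F0 /\
    forall F : list I, NoDup F -> List.Forall P F -> incl F0 F ->
      (Cmod (Csum_list f F - s) < eps)%R.

(* Main.v *)
Require Import Defs.
From Stdlib Require Import Permutation Compare_dec PeanoNat Lia Lra.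

Local Open Scope C_scope.

(** Write [D r = 1 + z q^r] and [t k = q^k / D (2k+1)], so that [S3] is the sum
    of all [t k].

    Fix [n >= 1] and sum over [m] first.  Expanding [1 / (1 - q^(2m-1))] as a
    geometric series and exchanging the two sums turns the sum over [m] into
    [- z q^(n+1)] times the tail [t n + t (n+1) + ...] ([lambert_tail]).  With
    [n = i + 1] the double series becomes
      [- x z q^2 * sum_i (x q)^i / D (i+1) * (S3 - (t 0 + ... + t i))].
    The part with [S3] is [- x z q^2 * S3 * S4].  In the other part, the finite
    identity [convolution_identity]
      [(t 0 + ... + t i) / D (i+1) = sum_(k <= i) t k / D (2(i-k)+1)]
    shows that the term of index [i] is the [i]-th coefficient of the Cauchy
    product of the series [S1] and [S2].

    The analysis is the same at all three places where sums are rearranged (the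
    Lambert expansion, the Cauchy product, the unordered double sum): the family
    is bounded by [A * a^m * b^n] with [a, b < 1].  For such a family the sums
    over large squares approximate both iterated sums ([square_sum_error]), which
    are therefore equal ([geom_dominated_fubini]), and little weight lies outside
    a large square, so that the unordered sum has the same value
    ([geom_dominated_unordered_sum]). *)

(** * Geometrically dominated series *)

Lemma is_series_C_scal (k : C) (u : nat -> C) (s : C) :
  is_series u s -> is_series (fun n => k * u n) (k * s).
Proof. exact (is_series_scal k u s). Qed.

Lemma is_series_C_unique (u : nat -> C) (s t : C) :
  is_series u s -> is_series u t -> s = t.
Proof.
  intros Hs Ht.
  exact (filterlim_locally_unique (V := C_NormedModule) (sum_n u) s t Hs Ht).
Qed.

Lemma is_series_Cmod_le (u : nat -> C) (v : nat -> R) (s : C) (t : R) :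
  (forall n, Cmod (u n) <= v n)%R -> is_series u s -> is_series v t ->
  (Cmod s <= t)%R.
Proof.
  intros Huv Hu Hv.
  assert (Hsum : forall n, (norm (sum_n u n) <= sum_n v n)%R).
  { intros n. apply Rle_trans with (1 := norm_sum_n_m u 0 n).
    apply sum_n_m_le. exact Huv. }
  apply (filterlim_le (F := eventually) (fun n => norm (sum_n u n)) (sum_n v)
           (Cmod s) t).
  - exists 0%nat. intros n _. apply Hsum.
  - apply (filterlim_comp _ _ _ (sum_n u) norm _ _ _ Hu).
    apply (filterlim_norm (V := C_NormedModule)).
  - exact Hv.
Qed.

Lemma is_series_geom_scal (A c : R) :
  (0 <= c < 1)%R -> is_series (fun n => A * c ^ n)%R (A * / (1 - c))%R.
Proof.
  intros Hc. apply (is_series_scal (K := R_AbsRing) A (fun n => c ^ n)%R).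
  apply is_series_geom. rewrite Rabs_pos_eq; lra.
Qed.

Lemma geom_dominated_series (u : nat -> C) (A c : R) :
  (0 <= c < 1)%R -> (forall n, Cmod (u n) <= A * c ^ n)%R ->
  exists s : C, is_series u s /\ (Cmod s <= A * / (1 - c))%R.
Proof.
  intros Hc Hu.
  pose proof (is_series_geom_scal A c Hc) as Hg.
  destruct (ex_series_le u (fun n => A * c ^ n)%R Hu (ex_intro _ _ Hg)) as [s Hs].
  exists s. split; [exact Hs|].
  exact (is_series_Cmod_le _ _ _ _ Hu Hs Hg).
Qed.

(** Removing the first term of the series multiplies it by [w], so its sum
    [s] satisfies [s = 1 + w * s]. *)
Lemma is_series_geom_C (w : C) :
  (Cmod w < 1)%R -> is_series (fun n => w ^ n) (/ (1 - w)).
Proof.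
  intros Hw.
  destruct (geom_dominated_series (fun n => w ^ n) 1 (Cmod w)) as (s & Hs & _).
  - split; [apply Cmod_ge_0|exact Hw].
  - intros n. rewrite Cmod_pow. lra.
  - assert (H1 : is_series (fun n => w ^ n) (1 + w * s)).
    { apply is_series_decr_1.
      refine (eq_ind (w * s) (is_series _) (is_series_C_scal w _ _ Hs) _ _).
      change (w * s = 1 + w * s + - (1)). ring. }
    pose proof (is_series_C_unique _ _ _ Hs H1) as E.
    assert (Hnz : 1 - w <> 0).
    { intros E1.
      assert (Ew : w = 1) by (replace w with (1 - (1 - w)) by ring; rewrite E1; ring).
      rewrite Ew, Cmod_1 in Hw. lra. }
    assert (E' : (1 - w) * s = 1).
    { transitivity (s - w * s); [ring|]. rewrite E at 1. ring. }
    refine (eq_ind s (is_series _) Hs _ _).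
    transitivity (/ (1 - w) * ((1 - w) * s)); [field; exact Hnz|].
    rewrite E'. apply Cmult_1_r.
Qed.

Lemma geom_dominated_tail (u : nat -> C) (A c : R) (s : C) (N : nat) :
  (0 <= c < 1)%R -> (forall n, Cmod (u n) <= A * c ^ n)%R ->
  is_series u s ->
  (Cmod (sum_n u N - s) <= A * c ^ S N * / (1 - c))%R.
Proof.
  intros Hc Hu Hs.
  assert (Ht : is_series (fun k => u (S N + k)%nat) (s - sum_n u N)).
  { apply is_series_incr_n; [lia|]. simpl Init.Nat.pred.
    refine (eq_ind s (is_series u) Hs _ _).
    change (s = s - sum_n u N + sum_n u N). ring. }
  replace (sum_n u N - s) with (- (s - sum_n u N)) by ring.
  rewrite Cmod_opp.
  apply (is_series_Cmod_le _ (fun k => A * c ^ S N * c ^ k)%R _ _) with (2 := Ht).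
  - intros n. rewrite Rmult_assoc, <- pow_add. apply Hu.
  - apply is_series_geom_scal, Hc.
Qed.

Lemma sum_n_geom (A c : R) (N : nat) :
  (c <> 1)%R ->
  sum_n (fun n => A * c ^ n)%R N = (A * (1 - c ^ S N) * / (1 - c))%R.
Proof.
  intros Hc. induction N as [|N IH].
  - rewrite sum_O. simpl. field. lra.
  - rewrite sum_Sn, IH. unfold plus; simpl. field. lra.
Qed.

Lemma sum_n_geom_le (A c : R) (N : nat) :
  (0 <= A)%R -> (0 <= c < 1)%R ->
  (sum_n (fun n => A * c ^ n)%R N <= A * / (1 - c))%R.
Proof.
  intros HA Hc. rewrite sum_n_geom by lra. apply Rmult_le_compat_r.
  - left. apply Rinv_0_lt_compat. lra.
  - pose proof (pow_le c (S N) (proj1 Hc)). nra.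
Qed.

(** * Geometrically dominated double series *)

(** A product of two geometric bounds is stable under exchanging the indices
    and makes rows, columns and the series of their sums converge absolutely
    with explicit tails. *)
Definition geom_dominated (f : nat -> nat -> C) (A a b : R) : Prop :=
  (0 <= A)%R /\ (0 <= a < 1)%R /\ (0 <= b < 1)%R /\
  forall m n, (Cmod (f m n) <= A * (a ^ m * b ^ n))%R.

Definition square_sum (f : nat -> nat -> C) (N : nat) : C :=
  sum_n (fun m => sum_n (f m) N) N.

Lemma geom_dominated_swap (f : nat -> nat -> C) (A a b : R) :
  geom_dominated f A a b -> geom_dominated (fun n m => f m n) A b a.
Proof.
  intros (HA & Ha & Hb & Hf). repeat split; try tauto.
  intros n m. rewrite (Rmult_comm (b ^ n)). apply Hf.
Qed.

Lemma square_sum_swap (f : nat -> nat -> C) (N : nat) :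
  square_sum (fun n m => f m n) N = square_sum f N.
Proof. apply (sum_n_switch (fun n m => f m n) N N). Qed.

Lemma row_sum_bound (f : nat -> nat -> C) (A a b : R) (r : nat -> C) :
  geom_dominated f A a b -> (forall m, is_series (f m) (r m)) ->
  forall m, (Cmod (r m) <= A * / (1 - b) * a ^ m)%R.
Proof.
  intros (HA & Ha & Hb & Hf) Hr m.
  apply (is_series_Cmod_le (f m) (fun n => (A * a ^ m) * b ^ n)%R) with (2 := Hr m).
  - intros n. rewrite Rmult_assoc. apply Hf.
  - replace (A * / (1 - b) * a ^ m)%R with (A * a ^ m * / (1 - b))%R by ring.
    apply is_series_geom_scal, Hb.
Qed.

Lemma row_sums_summable (f : nat -> nat -> C) (A a b : R) (r : nat -> C) :
  geom_dominated f A a b -> (forall m, is_series (f m) (r m)) ->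
  exists L : C, is_series r L.
Proof.
  intros Hdom Hr.
  destruct (geom_dominated_series r (A * / (1 - b)) a) as [L [HL _]].
  - apply Hdom.
  - exact (row_sum_bound f A a b r Hdom Hr).
  - now exists L.
Qed.

(** The square misses two kinds of entries: the ends of the rows
    [0, ..., N], geometric tails in [b], and all the rows beyond [N], whose sums
    form a geometric tail in [a]. *)
Lemma square_sum_error (f : nat -> nat -> C) (A a b : R) (r : nat -> C) (L : C)
  (N : nat) :
  geom_dominated f A a b -> (forall m, is_series (f m) (r m)) ->
  is_series r L ->
  (Cmod (square_sum f N - L) <=
     A * / (1 - a) * / (1 - b) * (a ^ S N + b ^ S N))%R.
Proof.
  intros Hdom Hr HL.
  pose proof (row_sum_bound f A a b r Hdom Hr) as Hrow.
  destruct Hdom as (HA & Ha & Hb & Hf).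
  assert (Hia : (0 < / (1 - a))%R) by (apply Rinv_0_lt_compat; lra).
  assert (Hib : (0 < / (1 - b))%R) by (apply Rinv_0_lt_compat; lra).
  replace (square_sum f N - L) with
    ((square_sum f N - sum_n r N) + (sum_n r N - L)) by ring.
  apply Rle_trans with (1 := Cmod_triangle _ _).
  rewrite Rmult_plus_distr_l, Rplus_comm. apply Rplus_le_compat.
  - replace (A * / (1 - a) * / (1 - b) * a ^ S N)%R
      with (A * / (1 - b) * a ^ S N * / (1 - a))%R by ring.
    apply geom_dominated_tail; assumption.
  - assert (E : square_sum f N - sum_n r N = sum_n (fun m => sum_n (f m) N - r m) N).
    { unfold square_sum. generalize N at 2 3 5. intros M. induction M as [|M IH].
      - now rewrite !sum_O.
      - rewrite !sum_Sn, <- IH. unfold plus; simpl. ring. }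
    rewrite E.
    apply Rle_trans with (1 := norm_sum_n_m (V := C_NormedModule) _ 0 N).
    replace (A * / (1 - a) * / (1 - b) * b ^ S N)%R
      with (A * b ^ S N * / (1 - b) * / (1 - a))%R by ring.
    apply Rle_trans with (sum_n (fun m => A * b ^ S N * / (1 - b) * a ^ m)%R N).
    + apply sum_n_m_le. intros m.
      replace (A * b ^ S N * / (1 - b) * a ^ m)%R
        with ((A * a ^ m) * b ^ S N * / (1 - b))%R by ring.
      apply geom_dominated_tail; [exact Hb| |apply Hr].
      intros n. rewrite Rmult_assoc. apply Hf.
    + apply sum_n_geom_le; [|exact Ha].
      apply Rmult_le_pos; [|lra]. apply Rmult_le_pos; [lra|]. apply pow_le, Hb.
Qed.

Lemma square_error_small (K a b eps : R) :
  (0 <= a < 1)%R -> (0 <= b < 1)%R -> (0 < eps)%R ->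
  exists N, (K * (a ^ S N + b ^ S N) < eps)%R.
Proof.
  intros Ha Hb He.
  assert (Hl : is_lim_seq (fun N => K * (a ^ S N + b ^ S N))%R 0).
  { replace (Finite 0) with (Rbar_mult K (Finite (0 + 0)))
      by (simpl; f_equal; ring).
    apply is_lim_seq_scal_l. apply is_lim_seq_plus'.
    - apply (is_lim_seq_incr_1 (fun n => a ^ n)%R), is_lim_seq_geom.
      rewrite Rabs_pos_eq; lra.
    - apply (is_lim_seq_incr_1 (fun n => b ^ n)%R), is_lim_seq_geom.
      rewrite Rabs_pos_eq; lra. }
  apply is_lim_seq_spec in Hl. destruct (Hl (mkposreal eps He)) as [N HN].
  exists N. specialize (HN N (le_n N)). simpl in HN.
  apply Rle_lt_trans with (1 := Rle_abs _). rewrite Rminus_0_r in HN. exact HN.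
Qed.

(** The square partial sums do not change when rows and columns are exchanged,
    and they converge to either iterated sum. *)
Theorem geom_dominated_fubini (f : nat -> nat -> C) (A a b : R) (r c : nat -> C) :
  geom_dominated f A a b ->
  (forall m, is_series (f m) (r m)) ->
  (forall n, is_series (fun m => f m n) (c n)) ->
  exists L : C, is_series r L /\ is_series c L.
Proof.
  intros Hdom Hr Hc.
  pose proof (geom_dominated_swap _ _ _ _ Hdom) as Hdom'.
  destruct (row_sums_summable _ _ _ _ _ Hdom Hr) as [L HL].
  destruct (row_sums_summable _ _ _ _ _ Hdom' Hc) as [L' HL'].
  exists L. split; [exact HL|].
  refine (eq_ind (L' : C) (is_series c) HL' L _).
  destruct (Ceq_dec (L' - L) 0) as [E|E].
  { transitivity (L' - L + L); [|rewrite E]; ring. }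
  exfalso. apply Cmod_gt_0 in E.
  pose proof Hdom as (_ & Ha & Hb & _).
  destruct (square_error_small (A * / (1 - a) * / (1 - b)) a b (Cmod (L' - L) / 2))
    as [N HN]; try assumption; [lra|].
  pose proof (square_sum_error _ _ _ _ _ _ N Hdom Hr HL) as H1.
  pose proof (square_sum_error _ _ _ _ _ _ N Hdom' Hc HL') as H2.
  rewrite square_sum_swap in H2.
  assert (H3 : (Cmod (L' - L) <= Cmod (square_sum f N - L') + Cmod (square_sum f N - L))%R).
  { replace (L' - L) with (- (square_sum f N - L') + (square_sum f N - L)) by ring.
    apply Rle_trans with (1 := Cmod_triangle _ _). rewrite Cmod_opp. lra. }
  replace (A * / (1 - b) * / (1 - a) * (b ^ S N + a ^ S N))%R
    with (A * / (1 - a) * / (1 - b) * (a ^ S N + b ^ S N))%R in H2 by ring.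
  lra.
Qed.

Lemma is_series_finite (u : nat -> C) (N : nat) :
  (forall k, (N < k)%nat -> u k = 0) -> is_series u (sum_n u N).
Proof.
  intros Hu. apply (filterlim_ext_loc (fun _ => sum_n u N));
    [|apply filterlim_const].
  exists N. intros n Hn. induction Hn as [|n Hn IH]; [reflexivity|].
  rewrite sum_Sn, Hu, <- IH by lia. exact (eq_sym (Cplus_0_r _)).
Qed.

(** Row [n] of the triangular array [u (n - k) * v k], [k <= n], is the [n]-th
    coefficient of the Cauchy product, and column [k] is the shifted series
    [v k * u], of sum [v k * U].  Exchanging the summations gives the claim. *)
Theorem geom_dominated_cauchy_product (u v : nat -> C) (A B c : R) (U V : C) :
  (0 <= c < 1)%R ->
  (forall n, Cmod (u n) <= A * c ^ n)%R -> (forall n, Cmod (v n) <= B * c ^ n)%R ->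
  is_series u U -> is_series v V ->
  is_series (fun n => sum_n (fun k => u (n - k)%nat * v k) n) (U * V).
Proof.
  intros Hc Hu Hv HU HV.
  set (g := fun n k : nat => if le_dec k n then u (n - k)%nat * v k else 0).
  assert (HA : (0 <= A)%R).
  { specialize (Hu 0%nat). simpl in Hu. pose proof (Cmod_ge_0 (u 0%nat)). lra. }
  assert (HB : (0 <= B)%R).
  { specialize (Hv 0%nat). simpl in Hv. pose proof (Cmod_ge_0 (v 0%nat)). lra. }
  (* The entries of row [n] are of size [c ^ n] for all [k <= n]; since
     [c ^ n = d ^ n * d ^ n <= d ^ n * d ^ k], the square root of [c]
     dominates in both indices. *)
  set (d := sqrt c).
  assert (Hd0 : (0 <= d)%R) by apply sqrt_pos.
  assert (Hdd : (d * d = c)%R) by (apply sqrt_sqrt; lra).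
  assert (Hd : (0 <= d < 1)%R) by (split; [exact Hd0|nra]).
  assert (Hdom : geom_dominated g (A * B) d d).
  { repeat split; try tauto; [apply Rmult_le_pos; assumption|].
    intros n k. unfold g. destruct (le_dec k n) as [Hk|Hk].
    - rewrite Cmod_mult.
      apply Rle_trans with ((A * c ^ (n - k)) * (B * c ^ k))%R.
      + apply Rmult_le_compat; try apply Cmod_ge_0; auto.
      + replace (A * c ^ (n - k) * (B * c ^ k))%R with (A * B * (c ^ (n - k) * c ^ k))%R
          by ring.
        apply Rmult_le_compat_l; [apply Rmult_le_pos; assumption|].
        rewrite <- pow_add. replace (n - k + k)%nat with n by lia.
        rewrite <- Hdd, Rpow_mult_distr.
        apply Rmult_le_compat_l; [apply pow_le, Hd0|].
        replace n with (k + (n - k))%nat by lia. rewrite pow_add.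
        rewrite <- (Rmult_1_r (d ^ k)) at 2.
        apply Rmult_le_compat_l; [apply pow_le, Hd0|].
        rewrite <- (pow1 (n - k)). apply pow_incr. lra.
    - rewrite Cmod_0. apply Rmult_le_pos; [apply Rmult_le_pos; assumption|].
      apply Rmult_le_pos; apply pow_le; exact Hd0. }
  destruct (geom_dominated_fubini g (A * B) d d
              (fun n => sum_n (fun k => u (n - k)%nat * v k) n)
              (fun k => v k * U) Hdom) as [L [HL HL']].
  - intros n.
    assert (E : sum_n (fun k => u (n - k)%nat * v k) n = sum_n (g n) n).
    { apply sum_n_ext_loc. intros k Hk. unfold g. now destruct (le_dec k n). }
    rewrite E. apply is_series_finite. intros k Hk. unfold g.
    destruct (le_dec k n); [lia|reflexivity].
  - intros k.
    assert (Hshift : is_series (fun j => g (k + j)%nat k) (v k * U)).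
    { apply (is_series_ext (fun j => v k * u j)); [|apply is_series_C_scal, HU].
      intros j. unfold g. destruct (le_dec k (k + j)); [|lia].
      replace (k + j - k)%nat with j by lia. apply Cmult_comm. }
    destruct k as [|k]; [exact Hshift|].
    apply is_series_decr_n with (n := S k); [lia|]. simpl Init.Nat.pred.
    refine (eq_ind _ (is_series _) Hshift _ _).
    assert (E : sum_n (fun n => g n (S k)) k = RtoC 0).
    { rewrite (sum_n_ext_loc _ (fun _ => RtoC 0)).
      - exact (sum_n_m_const_zero (G := C_AbelianMonoid) 0 k).
      - intros n Hn. unfold g. destruct (le_dec (S k) n); [lia|reflexivity]. }
    change (v (S k) * U = v (S k) * U + - (sum_n (fun n => g n (S k)) k : C)).
    rewrite E. ring.
  - refine (eq_ind L (is_series _) HL _ _).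
    apply (is_series_C_unique _ _ _ HL').
    apply (is_series_ext (fun k => U * v k)); [intros k; apply Cmult_comm|].
    apply is_series_C_scal, HV.
Qed.

(** * Unordered sums over pairs of positive integers *)

(** The list sum in any commutative monoid, so that the same lemmas serve for
    complex families and for their real majorants; over [C] it is convertible
    with [Csum_list]. *)
Definition Msum_list {G : AbelianMonoid} {I : Type} (f : I -> G) (F : list I) : G :=
  fold_right (fun i acc => plus (f i) acc) zero F.

Lemma Msum_list_app {G : AbelianMonoid} {I : Type} (f : I -> G) (F F' : list I) :
  Msum_list f (F ++ F') = plus (Msum_list f F) (Msum_list f F').
Proof.
  induction F as [|i F IH]; simpl.
  - now rewrite plus_zero_l.
  - now rewrite IH, plus_assoc.
Qed.

Lemma Msum_list_perm {G : AbelianMonoid} {I : Type} (f : I -> G) (F F' : list I) :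
  Permutation F F' -> Msum_list f F = Msum_list f F'.
Proof.
  induction 1 as [|i F F' _ IH|i j F|F F' F'' _ IH _ IH']; simpl.
  - reflexivity.
  - now rewrite IH.
  - now rewrite !plus_assoc, (plus_comm (f i)).
  - now rewrite IH.
Qed.

Lemma Msum_list_map {G : AbelianMonoid} {I J : Type} (h : J -> I) (f : I -> G)
  (F : list J) : Msum_list f (map h F) = Msum_list (fun j => f (h j)) F.
Proof. induction F as [|j F IH]; simpl; [reflexivity|now rewrite IH]. Qed.

Lemma Msum_list_prod {G : AbelianMonoid} {I J : Type} (f : I * J -> G)
  (F : list I) (F' : list J) :
  Msum_list f (list_prod F F') =
  Msum_list (fun i => Msum_list (fun j => f (i, j)) F') F.
Proof.
  induction F as [|i F IH]; simpl; [reflexivity|].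
  now rewrite Msum_list_app, Msum_list_map, IH.
Qed.

Lemma Msum_list_seq {G : AbelianMonoid} (f : nat -> G) (N : nat) :
  Msum_list f (seq 1 (S N)) = sum_n (fun k => f (S k)) N.
Proof.
  induction N as [|N IH].
  - simpl. now rewrite sum_O, plus_zero_r.
  - rewrite seq_S, Msum_list_app, IH, sum_Sn. simpl. now rewrite plus_zero_r.
Qed.

Lemma NoDup_incl_split {I : Type} (R F : list I) :
  NoDup R -> incl R F -> exists G, Permutation F (R ++ G).
Proof.
  revert F. induction R as [|i R IH]; intros F HR HF; [now exists F|].
  apply NoDup_cons_iff in HR as [Hi HR].
  destruct (in_split i F (HF i (or_introl eq_refl))) as (F1 & F2 & ->).
  destruct (IH (F1 ++ F2) HR) as [G HG].
  - intros j Hj. specialize (HF j (or_intror Hj)).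
    apply in_app_or in HF. apply in_or_app. simpl in HF.
    destruct HF as [?|[->|?]]; tauto.
  - exists G. simpl. rewrite <- HG. symmetry. apply Permutation_middle.
Qed.

Lemma Cmod_Csum_list_le {I : Type} (f : I -> C) (w : I -> R) (F : list I) :
  (forall i, In i F -> (Cmod (f i) <= w i)%R) ->
  (Cmod (Csum_list f F) <= Msum_list w F)%R.
Proof.
  induction F as [|i F IH]; intros H; simpl.
  - rewrite Cmod_0. apply Rle_refl.
  - apply Rle_trans with (1 := Cmod_triangle _ _).
    apply Rplus_le_compat; [|apply IH; intros j Hj]; apply H; simpl; tauto.
Qed.

Definition square (N : nat) : list (nat * nat) :=
  list_prod (seq 1 (S N)) (seq 1 (S N)).

Lemma in_square (N : nat) (p : nat * nat) :
  In p (square N) <-> (1 <= fst p <= S N)%nat /\ (1 <= snd p <= S N)%nat.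
Proof.
  destruct p as [m n]. unfold square. rewrite in_prod_iff, !in_seq. simpl. lia.
Qed.

Lemma NoDup_list_prod {I J : Type} (F : list I) (F' : list J) :
  NoDup F -> NoDup F' -> NoDup (list_prod F F').
Proof.
  intros HF HF'. induction F as [|i F IH]; simpl; [constructor|].
  apply NoDup_cons_iff in HF as [Hi HF]. apply NoDup_app.
  - apply FinFun.Injective_map_NoDup; [|exact HF'].
    intros j k E. congruence.
  - apply IH, HF.
  - intros [m n] H1 H2. apply in_map_iff in H1 as (j & E & _).
    apply in_prod_iff in H2. injection E as -> ->. tauto.
Qed.

Lemma NoDup_square (N : nat) : NoDup (square N).
Proof. apply NoDup_list_prod; apply seq_NoDup. Qed.

Lemma Msum_list_square {G : AbelianMonoid} (g : nat * nat -> G) (N : nat) :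
  Msum_list g (square N) = sum_n (fun m => sum_n (fun n => g (S m, S n)) N) N.
Proof.
  unfold square. rewrite Msum_list_prod, Msum_list_seq.
  apply sum_n_ext. intros m. apply Msum_list_seq.
Qed.

(** A finite set of pairs outside the square [N] fits, together with that
    square, into a larger square [M], so its weight is at most the difference
    of the weights of the two squares, which are products of geometric sums. *)
Lemma geom_mass_outside_square (A a b : R) (N : nat) (G : list (nat * nat)) :
  (0 <= A)%R -> (0 <= a < 1)%R -> (0 <= b < 1)%R ->
  NoDup (square N ++ G) ->
  List.Forall (fun p => (1 <= fst p)%nat /\ (1 <= snd p)%nat) G ->
  (Msum_list (fun p => A * (a ^ pred (fst p) * b ^ pred (snd p))) G <=
     A * / (1 - a) * / (1 - b) * (a ^ S N + b ^ S N))%R.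
Proof.
  intros HA Ha Hb Hnd HG.
  set (w := fun p : nat * nat => (A * (a ^ pred (fst p) * b ^ pred (snd p)))%R).
  assert (Hw : forall p, (0 <= w p)%R).
  { intros p. apply Rmult_le_pos; [exact HA|].
    apply Rmult_le_pos; apply pow_le; tauto. }
  assert (Hsq : forall M, Msum_list w (square M) =
            (A * ((1 - a ^ S M) * / (1 - a)) * ((1 - b ^ S M) * / (1 - b)))%R).
  { intros M. rewrite Msum_list_square.
    transitivity (sum_n (fun m => A * ((1 - b ^ S M) * / (1 - b)) * a ^ m)%R M).
    - apply sum_n_ext. intros m.
      transitivity (sum_n (fun n => A * a ^ m * b ^ n)%R M).
      + apply sum_n_ext. intros n. symmetry. apply Rmult_assoc.
      + rewrite sum_n_geom by lra. simpl. ring.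
    - rewrite sum_n_geom by lra. simpl. ring. }
  set (M := Nat.max N (list_max (map (fun p => fst p + snd p)%nat G))).
  destruct (NoDup_incl_split (square N ++ G) (square M) Hnd) as [G' HG'].
  { intros p Hp. apply in_square. apply in_app_or in Hp as [Hp|Hp].
    - apply in_square in Hp. unfold M. lia.
    - pose proof (proj1 (Forall_forall _ _) HG p Hp) as Hp1. simpl in Hp1.
      assert (Hp2 : (fst p + snd p <= list_max (map (fun p => fst p + snd p) G))%nat).
      { set (l := map (fun p => fst p + snd p)%nat G).
        pose proof (proj1 (list_max_le l _) (le_n (list_max l))) as H.
        rewrite Forall_forall in H. apply H.
        apply in_map_iff. exists p. tauto. }
      unfold M. lia. }
  apply (Msum_list_perm w) in HG'. rewrite !Msum_list_app, !Hsq in HG'.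
  unfold plus in HG'; simpl in HG'.
  assert (HG'0 : (0 <= Msum_list w G')%R).
  { clear - Hw. induction G' as [|p G' IH]; simpl; [apply Rle_refl|].
    apply Rplus_le_le_0_compat; [apply Hw|exact IH]. }
  change (fun p : nat * nat => (A * (a ^ Init.Nat.pred (fst p) * b ^ Init.Nat.pred (snd p)))%R)
    with w.
  set (K := (A * / (1 - a) * / (1 - b))%R).
  assert (HK : (0 <= K)%R).
  { unfold K. repeat apply Rmult_le_pos; try assumption;
      left; apply Rinv_0_lt_compat; lra. }
  assert (E : (K * ((1 - a ^ S M) * (1 - b ^ S M)) =
     K * ((1 - a ^ S N) * (1 - b ^ S N)) + Msum_list w G + Msum_list w G')%R).
  { unfold K. simpl. lra. }
  assert (H1 : ((1 - a ^ S M) * (1 - b ^ S M) <= 1)%R).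
  { assert (0 <= a ^ S M <= 1)%R.
    { split; [apply pow_le; tauto|]. rewrite <- (pow1 (S M)). apply pow_incr. lra. }
    assert (0 <= b ^ S M)%R by (apply pow_le; tauto). nra. }
  assert (H2 : (1 - (a ^ S N + b ^ S N) <= (1 - a ^ S N) * (1 - b ^ S N))%R).
  { assert (0 <= a ^ S N)%R by (apply pow_le; tauto).
    assert (0 <= b ^ S N)%R by (apply pow_le; tauto). nra. }
  apply (Rmult_le_compat_l K) in H1; [|exact HK].
  apply (Rmult_le_compat_l K) in H2; [|exact HK].
  lra.
Qed.

(** A finite set that contains a large square differs from it by a set of small
    weight, and the sum over the square is close to the iterated sum. *)
Theorem geom_dominated_unordered_sum (g : nat * nat -> C) (A a b : R)
  (c : nat -> C) (L : C) :
  geom_dominated (fun m n => g (S m, S n)) A a b ->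
  (forall n, is_series (fun m => g (S m, S n)) (c n)) -> is_series c L ->
  is_unordered_sum (fun p => (1 <= fst p)%nat /\ (1 <= snd p)%nat) g L.
Proof.
  intros Hdom Hc HL eps.
  pose proof Hdom as (HA & Ha & Hb & Hg).
  destruct (square_error_small (A * / (1 - a) * / (1 - b)) a b (eps / 2))
    as [N HN]; try assumption; [destruct eps; simpl; lra|].
  exists (square N). split.
  { apply Forall_forall. intros p Hp. apply in_square in Hp. tauto. }
  intros F HF HP Hsub.
  destruct (NoDup_incl_split (square N) F (NoDup_square N) Hsub) as [G HG].
  assert (Esum : Csum_list g F - L =
    (square_sum (fun m n => g (S m, S n)) N - L) + Csum_list g G).
  { assert (E : Csum_list g F = square_sum (fun m n => g (S m, S n)) N + Csum_list g G).
    { change (Msum_list g F = plus (square_sum (fun m n => g (S m, S n)) N) (Msum_list g G)).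
      rewrite (Msum_list_perm g _ _ HG), Msum_list_app. f_equal.
      apply Msum_list_square. }
    rewrite E. ring. }
  rewrite Esum. apply Rle_lt_trans with (1 := Cmod_triangle _ _).
  pose proof (square_sum_error _ _ _ _ _ _ N (geom_dominated_swap _ _ _ _ Hdom) Hc HL)
    as H1.
  rewrite square_sum_swap in H1.
  assert (HPG : List.Forall (fun p => (1 <= fst p)%nat /\ (1 <= snd p)%nat) G).
  { rewrite Forall_forall in HP |- *. intros p Hp. apply HP.
    apply (Permutation_in p (Permutation_sym HG)), in_or_app. tauto. }
  pose proof (geom_mass_outside_square A a b N G HA Ha Hb
                (Permutation_NoDup HG HF) HPG) as H2.
  pose proof (Cmod_Csum_list_le g
    (fun p => A * (a ^ pred (fst p) * b ^ pred (snd p)))%R G) as H3.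
  assert (H4 : forall p, In p G ->
    (Cmod (g p) <= A * (a ^ pred (fst p) * b ^ pred (snd p)))%R).
  { intros [m n] Hp. rewrite Forall_forall in HPG. specialize (HPG _ Hp).
    simpl in HPG |- *. destruct m as [|m], n as [|n]; try lia. apply Hg. }
  specialize (H3 H4).
  set (K := (A * / (1 - a) * / (1 - b))%R) in *.
  replace (A * / (1 - b) * / (1 - a))%R with K in H1 by (unfold K; ring).
  lra.
Qed.

(** * The Lambert-type series *)

Lemma Cmod_pow_le_1 (q : C) :
  (Cmod q < 1)%R -> forall r, (Cmod (q ^ r) <= 1)%R.
Proof.
  intros Hq r. rewrite Cmod_pow, <- (pow1 r). apply pow_incr.
  split; [apply Cmod_ge_0|lra].
Qed.

Lemma Cmod_one_minus_odd_pow (q : C) :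
  (Cmod q < 1)%R ->
  forall m, (1 - Cmod q <= Cmod (1 - q ^ (2 * S m - 1)))%R.
Proof.
  intros Hq m. replace (2 * S m - 1)%nat with (1 + 2 * m)%nat by lia.
  set (y := q ^ (1 + 2 * m)).
  assert (Hy : (Cmod y <= Cmod q)%R).
  { unfold y. rewrite Cpow_add_r, Cpow_1_r, Cmod_mult.
    pose proof (Cmod_pow_le_1 q Hq (2 * m)%nat). pose proof (Cmod_ge_0 q). nra. }
  assert (H1 : (Cmod 1 <= Cmod (1 - y) + Cmod y)%R).
  { replace (RtoC 1) with (1 - y + y) at 1 by ring. apply Cmod_triangle. }
  rewrite Cmod_1 in H1. lra.
Qed.

(** The denominators tend to [1] and none of them vanishes. *)
Lemma bounded_recip (z q : C) :
  (Cmod q < 1)%R -> (forall r, (1 <= r)%nat -> 1 + z * q ^ r <> 0) ->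
  exists B, (0 <= B)%R /\
    forall r, (1 <= r)%nat -> (Cmod (/ (1 + z * q ^ r)) <= B)%R.
Proof.
  intros Hq Hnz.
  assert (Hl : is_lim_seq (fun n => Cmod z * Cmod q ^ n)%R 0).
  { replace (Finite 0) with (Rbar_mult (Cmod z) 0) by (simpl; f_equal; ring).
    apply is_lim_seq_scal_l, is_lim_seq_geom.
    rewrite Rabs_pos_eq; [exact Hq|apply Cmod_ge_0]. }
  apply is_lim_seq_spec in Hl.
  destruct (Hl (mkposreal (1 / 2) ltac:(lra))) as [N HN]. simpl in HN.
  assert (Hfin : forall M, exists B, (2 <= B)%R /\ forall r, (1 <= r)%nat ->
            (r < M)%nat -> (Cmod (/ (1 + z * q ^ r)) <= B)%R).
  { intros M. induction M as [|M (B & HB & IH)].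
    - exists 2%R. split; [lra|]. intros r _ Hr. lia.
    - exists (Rmax B (Cmod (/ (1 + z * q ^ M)))). split.
      + apply Rle_trans with (1 := HB), Rmax_l.
      + intros r Hr HrM. destruct (Nat.eq_dec r M) as [->|Hne]; [apply Rmax_r|].
        apply Rle_trans with B; [apply IH; lia|apply Rmax_l]. }
  destruct (Hfin N) as (B & HB & Hsmall). exists B. split; [lra|].
  intros r Hr. destruct (lt_dec r N) as [HrN|HrN]; [now apply Hsmall|].
  apply Rle_trans with (2 := HB).
  specialize (HN r ltac:(lia)). rewrite Rminus_0_r in HN.
  apply (Rle_lt_trans _ _ _ (Rle_abs _)) in HN.
  rewrite <- Cmod_pow, <- Cmod_mult in HN.
  rewrite Cmod_inv by now apply Hnz.
  replace 2%R with (/ (1 / 2))%R by lra.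
  apply Rinv_le_contravar; [lra|].
  assert (H1 : (Cmod 1 <= Cmod (1 + z * q ^ r) + Cmod (z * q ^ r))%R).
  { replace (RtoC 1) with (1 + z * q ^ r + - (z * q ^ r)) at 1 by ring.
    apply Rle_trans with (1 := Cmod_triangle _ _). rewrite Cmod_opp. lra. }
  rewrite Cmod_1 in H1. lra.
Qed.

Lemma sum_n_rev (u : nat -> C) (n : nat) :
  sum_n u n = sum_n (fun k => u (n - k)%nat) n.
Proof.
  induction n as [|n IH]; [now rewrite !sum_O|].
  rewrite sum_Sn, IH. unfold sum_n.
  rewrite (sum_Sn_m (fun k => u (S n - k)%nat)) by lia.
  rewrite <- sum_n_m_S. apply Cplus_comm.
Qed.

(** With [i = n - k], the terms of index [k] and [i] of the left-hand side add up
    to [(q ^ k + q ^ i) / ((1 + z q^(2k+1)) (1 + z q^(2i+1)))], and those of the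
    right-hand sum to this same value times [1 + z q^(n+1)], because
    [q^k q^(2i+1) + q^i q^(2k+1) = q^(n+1) (q^k + q^i)].  The identity is thus
    true for symmetrized terms, hence for twice the sums. *)
Lemma convolution_identity (q z : C) (n : nat) :
  (forall r, (1 <= r)%nat -> 1 + z * q ^ r <> 0) ->
  sum_n (fun k => / (1 + z * q ^ (2 * (n - k) + 1)) *
                  (q ^ k / (1 + z * q ^ (2 * k + 1)))) n =
  / (1 + z * q ^ (n + 1)) * sum_n (fun k => q ^ k / (1 + z * q ^ (2 * k + 1))) n.
Proof.
  intros Hnz.
  set (P := fun k => / (1 + z * q ^ (2 * (n - k) + 1)) *
                     (q ^ k / (1 + z * q ^ (2 * k + 1)))).
  set (t := fun k => q ^ k / (1 + z * q ^ (2 * k + 1))).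
  set (Q := fun k => / (1 + z * q ^ (n + 1)) * t k).
  replace (/ (1 + z * q ^ (n + 1)) * sum_n t n) with (sum_n Q n)
    by exact (sum_n_mult_l (K := C_Ring) _ t n).
  (* One of the two copies of each sum is read backwards. *)
  assert (E : sum_n P n + sum_n P n = sum_n Q n + sum_n Q n).
  { rewrite (sum_n_rev P n) at 2. rewrite (sum_n_rev Q n) at 2.
    change (plus (sum_n P n) (sum_n (fun k => P (n - k)%nat) n) =
            plus (sum_n Q n) (sum_n (fun k => Q (n - k)%nat) n)).
    rewrite <- !sum_n_plus. apply sum_n_ext_loc. intros k Hk.
    unfold P, Q, t. change plus with Cplus. simpl.
    replace (n - (n - k))%nat with k by lia.
    pose proof (Hnz (n + 1)%nat ltac:(lia)) as H1.
    pose proof (Hnz (2 * k + 1)%nat ltac:(lia)) as H2.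
    pose proof (Hnz (2 * (n - k) + 1)%nat ltac:(lia)) as H3.
    revert H1 H2 H3. replace (n + 1)%nat with (k + (n - k) + 1)%nat by lia.
    generalize (n - k)%nat. intros j.
    simpl Nat.mul. rewrite !Nat.add_0_r, !Cpow_add_r, Cpow_1_r.
    intros H1 H2 H3. field. repeat split; assumption. }
  assert (Hhalf : forall s : C, s = / 2 * (s + s)).
  { intros s. field. }
  rewrite (Hhalf (sum_n P n)), E. symmetry. apply Hhalf.
Qed.

(** Expanding [/ (1 - q^(2m+1))] as a geometric series in [j] and exchanging the
    sums, the sum over [m] becomes geometric of ratio [- z q^(2n+3+2j)], and the
    result is a series in [j] whose terms are [- z q^(n+2)] times those of [S3]
    from the index [S n] on. *)
Lemma lambert_tail (q z : C) (n : nat) (S3 : C) :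
  (0 < Cmod q < 1)%R -> (Cmod (z * q ^ 3) < 1)%R ->
  is_series (fun k => q ^ k / (1 + z * q ^ (2 * k + 1))) S3 ->
  exists s : C,
  s = - (z * q ^ (n + 2)) * (S3 - sum_n (fun k => q ^ k / (1 + z * q ^ (2 * k + 1))) n) /\
  is_series (fun m => (- (z * q ^ (2 * n + 3))) ^ S m / (1 - q ^ (2 * m + 1))) s.
Proof.
  intros Hq Hzq HS3.
  pose proof (Cmod_pow_le_1 q (proj2 Hq)) as Hqpow.
  assert (Hw : forall r, (Cmod (- (z * q ^ (r + 3))) <= Cmod (z * q ^ 3))%R).
  { intros r. rewrite Cmod_opp, Cpow_add_r.
    replace (z * (q ^ r * q ^ 3)) with (q ^ r * (z * q ^ 3)) by ring.
    rewrite Cmod_mult. pose proof (Hqpow r). pose proof (Cmod_ge_0 (z * q ^ 3)).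
    nra. }
  set (t := fun k => q ^ k / (1 + z * q ^ (2 * k + 1))).
  exists (- (z * q ^ (n + 2)) * (S3 - sum_n t n)). split; [reflexivity|].
  set (h := fun m j => (- (z * q ^ (2 * n + 3))) ^ S m * (q ^ (2 * m + 1)) ^ j).
  assert (Htail : is_series (fun j => - (z * q ^ (n + 2)) * t (S n + j)%nat)
                    (- (z * q ^ (n + 2)) * (S3 - sum_n t n))).
  { apply is_series_C_scal. apply is_series_incr_n; [lia|]. simpl Init.Nat.pred.
    refine (eq_ind S3 (is_series _) HS3 _ _).
    change (S3 = S3 - sum_n t n + sum_n t n). ring. }
  assert (Hdom : geom_dominated h 1 (Cmod (z * q ^ 3)) (Cmod q)).
  { pose proof (Cmod_ge_0 (z * q ^ 3)). pose proof (Cmod_ge_0 q).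
    repeat split; try lra.
    intros m j. unfold h. rewrite Rmult_1_l, Cmod_mult.
    apply Rmult_le_compat; try apply Cmod_ge_0.
    - rewrite Cmod_pow. apply Rle_trans with (Cmod (z * q ^ 3) ^ S m)%R.
      + apply pow_incr. split; [apply Cmod_ge_0|apply (Hw (2 * n)%nat)].
      + rewrite <- tech_pow_Rmult.
        assert (0 <= Cmod (z * q ^ 3) ^ m)%R by (apply pow_le; lra). nra.
    - rewrite <- Cpow_mult_r. replace ((2 * m + 1) * j)%nat with (2 * m * j + j)%nat by lia.
      rewrite Cpow_add_r, Cmod_mult, (Cmod_pow q j).
      assert (0 <= Cmod q ^ j)%R by (apply pow_le; lra).
      pose proof (Hqpow (2 * m * j)%nat). nra. }
  destruct (geom_dominated_fubini h 1 (Cmod (z * q ^ 3)) (Cmod q)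
    (fun m => (- (z * q ^ (2 * n + 3))) ^ S m / (1 - q ^ (2 * m + 1)))
    (fun j => - (z * q ^ (n + 2)) * t (S n + j)%nat) Hdom) as (L & HL & HL').
  - intros m. unfold h. apply is_series_C_scal, is_series_geom_C.
    replace (2 * m + 1)%nat with (1 + 2 * m)%nat by lia.
    rewrite Cpow_add_r, Cpow_1_r, Cmod_mult.
    apply Rle_lt_trans with (Cmod q * 1)%R; [|lra].
    apply Rmult_le_compat_l; [lra|apply Hqpow].
  - intros j. set (w := - (z * q ^ (2 * n + 2 * j + 3))).
    assert (Hw1 : (Cmod w < 1)%R).
    { apply Rle_lt_trans with (2 := Hzq). apply Hw. }
    replace (- (z * q ^ (n + 2)) * t (S n + j)%nat)
      with (- (z * q ^ (2 * n + 3 + j)) * / (1 - w)).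
    + apply (is_series_ext (fun m => - (z * q ^ (2 * n + 3 + j)) * w ^ m)).
      * intros m. unfold h, w. rewrite <- Cpow_mult_r.
        replace ((2 * m + 1) * j)%nat with (2 * j * m + j)%nat by lia.
        replace (2 * n + 2 * j + 3)%nat with (2 * n + 3 + 2 * j)%nat by lia.
        rewrite (Cpow_add_r q (2 * n + 3) (2 * j)), (Cpow_add_r q (2 * n + 3) j).
        rewrite (Cpow_add_r q (2 * j * m)), (Cpow_mult_r q (2 * j) m).
        replace (- (z * (q ^ (2 * n + 3) * q ^ (2 * j))))
          with (- (z * q ^ (2 * n + 3)) * q ^ (2 * j)) by ring.
        rewrite Cpow_mult_l, Cpow_S. refine (_ : @eq C _ _). ring.
      * apply is_series_C_scal, is_series_geom_C, Hw1.
    + unfold w, t.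
      replace (1 - - (z * q ^ (2 * n + 2 * j + 3)))
        with (1 + z * q ^ (2 * (S n + j) + 1)).
      * replace (2 * n + 3 + j)%nat with (n + 2 + (S n + j))%nat by lia.
        rewrite (Cpow_add_r q (n + 2) (S n + j)). unfold Cdiv. ring.
      * replace (2 * (S n + j) + 1)%nat with (2 * n + 2 * j + 3)%nat by lia. ring.
  - rewrite (is_series_C_unique _ _ _ Htail HL'). exact HL.
Qed.

(** * The double series *)

Theorem mainTheorem3 :
  forall q x z : C,
    (0 < Cmod q < 1)%R ->
    (Cmod (x * q) < 1)%R ->
    (Cmod (z * q ^ 3) < 1)%R ->
    (forall r : nat, (1 <= r)%nat -> z <> - / q ^ r) ->
    exists L S1 S2 S3 S4 : C,
      is_unordered_sum
        (fun p : nat * nat => (1 <= fst p)%nat /\ (1 <= snd p)%nat)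
        (fun p : nat * nat => let (m, n) := p in
          ((- (1)) ^ m * q ^ (2 * m * n + m) * x ^ n * z ^ m)
          / ((1 + z * q ^ n) * (1 - q ^ (2 * m - 1))))
        L /\
      is_series (fun k : nat => x ^ k * q ^ k / (1 + z * q ^ (2 * k + 1))) S1 /\
      is_series (fun k : nat => x ^ k * q ^ (2 * k) / (1 + z * q ^ (2 * k + 1))) S2 /\
      is_series (fun k : nat => q ^ k / (1 + z * q ^ (2 * k + 1))) S3 /\
      is_series (fun k : nat => x ^ k * q ^ k / (1 + z * q ^ (k + 1))) S4 /\
      L = x * z * q ^ 2 * S1 * S2 - x * z * q ^ 2 * S3 * S4.
Proof.
  intros q x z Hq Hxq Hzq Hz.
  assert (Hqnz : q <> 0) by (apply Cmod_gt_0; lra).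
  assert (Hnz : forall r, (1 <= r)%nat -> 1 + z * q ^ r <> 0).
  { intros r Hr E. apply (Hz r Hr). pose proof (Cpow_nz q r Hqnz) as Hqr.
    transitivity ((1 + z * q ^ r - 1) / q ^ r); [field; exact Hqr|].
    rewrite E. field. exact Hqr. }
  destruct (bounded_recip z q (proj2 Hq) Hnz) as (B & HB & Hrec).
  pose proof (Cmod_pow_le_1 q (proj2 Hq)) as Hqpow.
  assert (Hfrac : forall c r, (1 <= r)%nat ->
            (Cmod (c / (1 + z * q ^ r)) <= B * Cmod c)%R).
  { intros c r Hr. unfold Cdiv. rewrite Cmod_mult, Rmult_comm.
    apply Rmult_le_compat_r; [apply Cmod_ge_0|now apply Hrec]. }
  pose proof (Cmod_one_minus_odd_pow q (proj2 Hq)) as Hden.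
  assert (Hdnz : forall m, 1 - q ^ (2 * S m - 1) <> 0).
  { intros m. apply Cmod_gt_0. specialize (Hden m). lra. }
  pose proof (Cmod_ge_0 (x * q)) as Hxq0.
  set (u := fun k => x ^ k * q ^ k / (1 + z * q ^ (2 * k + 1))).
  set (v := fun k => x ^ k * q ^ (2 * k) / (1 + z * q ^ (2 * k + 1))).
  set (t := fun k => q ^ k / (1 + z * q ^ (2 * k + 1))).
  set (w := fun k => x ^ k * q ^ k / (1 + z * q ^ (k + 1))).
  assert (Hu : forall k, (Cmod (u k) <= B * Cmod (x * q) ^ k)%R).
  { intros k. rewrite <- Cmod_pow, Cpow_mult_l. apply Hfrac. lia. }
  assert (Hv : forall k, (Cmod (v k) <= B * Cmod (x * q) ^ k)%R).
  { intros k. apply Rle_trans with (1 := Hfrac _ (2 * k + 1)%nat ltac:(lia)).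
    apply Rmult_le_compat_l; [exact HB|].
    rewrite <- Cmod_pow, Cpow_mult_l.
    replace (2 * k)%nat with (k + k)%nat by lia.
    rewrite Cpow_add_r, Cmult_assoc, (Cmod_mult (x ^ k * q ^ k)).
    pose proof (Hqpow k). pose proof (Cmod_ge_0 (x ^ k * q ^ k)). nra. }
  assert (Ht : forall k, (Cmod (t k) <= B * Cmod q ^ k)%R).
  { intros k. rewrite <- Cmod_pow. apply Hfrac. lia. }
  assert (Hw : forall k, (Cmod (w k) <= B * Cmod (x * q) ^ k)%R).
  { intros k. rewrite <- Cmod_pow, Cpow_mult_l. apply Hfrac. lia. }
  destruct (geom_dominated_series u B (Cmod (x * q))) as (S1 & HS1 & _); [lra|exact Hu|].
  destruct (geom_dominated_series v B (Cmod (x * q))) as (S2 & HS2 & _); [lra|exact Hv|].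
  destruct (geom_dominated_series t B (Cmod q)) as (S3 & HS3 & _); [lra|exact Ht|].
  destruct (geom_dominated_series w B (Cmod (x * q))) as (S4 & HS4 & _); [lra|exact Hw|].
  exists (x * z * q ^ 2 * S1 * S2 - x * z * q ^ 2 * S3 * S4), S1, S2, S3, S4.
  refine (conj _ (conj HS1 (conj HS2 (conj HS3 (conj HS4 eq_refl))))).
  (* The last argument gives the sum over [m >= 1] of the column of index
     [S n]. *)
  apply (geom_dominated_unordered_sum _
           (Cmod (z * x * q ^ 3) * B * / (1 - Cmod q)) (Cmod (z * q ^ 3)) (Cmod (x * q))
           (fun n => x ^ S n / (1 + z * q ^ S n) * (- (z * q ^ (n + 2)) * (S3 - sum_n t n)))).
  - pose proof (Cmod_ge_0 (z * q ^ 3)).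
    assert (Hi : (0 < / (1 - Cmod q))%R) by (apply Rinv_0_lt_compat; lra).
    split; [|split; [lra|split; [lra|]]].
    + apply Rmult_le_pos; [|lra]. apply Rmult_le_pos; [apply Cmod_ge_0|exact HB].
    + intros m n.
      (* After the shift of both indices the power of [q] is
         [2mn + 3m + 2n + 3]: it supplies [(z q^3)^m], [(x q)^n] and the
         constant [q^3], and leaves [q^(2mn+n)], of modulus at most [1]. *)
      replace ((- (1)) ^ S m * q ^ (2 * S m * S n + S m) * x ^ S n * z ^ S m /
                ((1 + z * q ^ S n) * (1 - q ^ (2 * S m - 1))))
        with ((- (1)) ^ S m * ((z * x * q ^ 3) * / (1 + z * q ^ S n) *
                / (1 - q ^ (2 * S m - 1)) *
                ((z * q ^ 3) ^ m * (x * q) ^ n)) * q ^ (2 * m * n + n)).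
      * set (K := z * x * q ^ 3). set (i1 := / (1 + z * q ^ S n)).
        set (i2 := / (1 - q ^ (2 * S m - 1))).
        pose proof (Hqpow (2 * m * n + n)%nat) as Hq1.
        rewrite Cmod_mult, (Cmod_mult (_ ^ S m)), Cmod_pow, Cmod_m1, pow1, Rmult_1_l.
        match goal with |- (?a * _ <= _)%R => apply Rle_trans with a end.
        { pose proof (Cmod_ge_0 (K * i1 * i2 * ((z * q ^ 3) ^ m * (x * q) ^ n))). nra. }
        rewrite (Cmod_mult (K * i1 * i2)), (Cmod_mult (K * i1)), (Cmod_mult K),
          (Cmod_mult (_ ^ m)), !Cmod_pow.
        apply Rmult_le_compat_r.
        { apply Rmult_le_pos; apply pow_le; lra. }
        apply Rmult_le_compat; [| apply Cmod_ge_0| |].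
        { apply Rmult_le_pos; apply Cmod_ge_0. }
        { apply Rmult_le_compat_l; [apply Cmod_ge_0|apply Hrec; lia]. }
        unfold i2. rewrite Cmod_inv by apply Hdnz.
        apply Rinv_le_contravar; [lra|apply Hden].
      * replace (2 * S m * S n + S m)%nat
          with (3 * m + n + (2 * m * n + n) + 3)%nat by lia.
        rewrite !Cpow_add_r, !Cpow_mult_l, (Cpow_mult_r q 3 m), !(Cpow_S _ m), !(Cpow_S _ n).
        field. split; [apply Hdnz|]. rewrite <- Cpow_S. apply Hnz. lia.
  - intros n.
    destruct (lambert_tail q z n S3 Hq Hzq HS3) as (s & Es & Hs).
    fold t in Es. rewrite <- Es.
    apply (is_series_ext (fun m => x ^ S n / (1 + z * q ^ S n) *
             ((- (z * q ^ (2 * n + 3))) ^ S m / (1 - q ^ (2 * m + 1)))));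
      [|apply is_series_C_scal, Hs].
    intros m. refine (_ : @eq C _ _).
    replace (2 * m + 1)%nat with (2 * S m - 1)%nat by lia.
    replace (2 * S m * S n + S m)%nat with ((2 * n + 3) * S m)%nat by lia.
    rewrite Cpow_mult_r.
    replace (- (z * q ^ (2 * n + 3))) with (- (1) * z * q ^ (2 * n + 3)) by ring.
    rewrite !Cpow_mult_l. field. split; [apply Hdnz|apply Hnz; lia].
  - assert (Hconv : is_series (fun n => w n * sum_n t n) (S1 * S2)).
    { apply (is_series_ext (fun n => sum_n (fun k => u (n - k)%nat * v k) n)).
      - intros n. refine (_ : @eq C _ _). unfold w, Cdiv.
        rewrite <- Cmult_assoc. unfold t. rewrite <- (convolution_identity q z n Hnz).
        rewrite <- (sum_n_mult_l (K := C_Ring)). apply sum_n_ext_loc. intros k Hk.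
        unfold u, v. refine (_ : @eq C _ _). change mult with Cmult.
        replace (2 * k)%nat with (k + k)%nat at 1 by lia.
        replace (x ^ n * q ^ n) with (x ^ (n - k) * x ^ k * (q ^ (n - k) * q ^ k)).
        + rewrite (Cpow_add_r q k k). unfold Cdiv. ring.
        + rewrite <- !Cpow_add_r. now replace (n - k + k)%nat with n by lia.
      - apply (geom_dominated_cauchy_product u v B B (Cmod (x * q))); try assumption.
        lra. }
    refine (eq_ind (x * z * q ^ 2 * (S1 * S2) + (- (x * z * q ^ 2 * S3)) * S4)
              (is_series _) _ _ _); [|ring].
    apply (is_series_ext (fun n => plus (x * z * q ^ 2 * (w n * sum_n t n) : C)
             ((- (x * z * q ^ 2 * S3)) * w n : C))).
    + intros n. refine (_ : @eq C _ _). unfold w. change plus with Cplus.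
      replace (n + 1)%nat with (S n) by lia. rewrite Cpow_add_r, (Cpow_S x).
      unfold Cdiv. ring.
    + apply (is_series_plus (V := C_NormedModule)); apply is_series_C_scal; assumption.
Qed.
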